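(* Let $X$ be a finite poset, let $M$ be a linear extension of $X$, and let $k$ be a positive integer. Then there exist positive integers $n$ and $t$ such that, with $Y=\mathbf{n}^t$, for all linear extensions $L_1,L_2,\ldots,L_k$ of $Y$ there is an embedding $f:X\to Y$ (so $X'=f(X)$ induces a subposet of $Y$ isomorphic to $X$) such that for all $i=1,\ldots,k$ and all $a,b\in X$, we have $a<b$ in $M$ if and only if $f(a)<f(b)$ in $L_i$.
   Context: $\mathbf{n}^t$ denotes the product of $t$ copies of the $n$-element chain, i.e., the poset on $[n]^t$ ordered coordinatewise. An embedding $f:X\to Y$ is a map with $x\le y$ in $X$ iff $f(x)\le f(y)$ in $Y$. A linear extension of a poset is a linear order on its ground set containing its order relation. *)

(* Defs.v *)
From mathcomp Require Import all_boot all_order.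

Set Implicit Arguments.
Unset Strict Implicit.
Unset Printing Implicit Defensive.

Import Order.TTheory.
Local Open Scope order_scope.

(* The relation [L] is the non-strict order; the strict one is [lin_lt L]. *)
Definition linear_extension {d : Order.disp_t} {T : porderType d} (L : rel T)
  : Prop :=
  [/\ reflexive L, antisymmetric L, transitive L, total L
    & forall x y : T, x <= y -> L x y].

Definition lin_lt {T : eqType} (L : rel T) : rel T :=
  fun x y => (x != y) && L x y.

Definition embedding {d d' : Order.disp_t} {X : porderType d}
  {Y : porderType d'} (f : X -> Y) : Prop :=
  forall x y : X, x <= y <-> f x <= f y.

(* [t.-tupleprod] is the library's type of [t]-tuples with the coordinatewise
   order, as opposed to the lexicographic [t.-tuplelexi]. *)
Definition chain_power (n t : nat) : finPOrderType _ := t.-tupleprod 'I_n.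

(* Main.v *)
Require Import Defs.
From mathcomp Require Import all_boot all_order.
From mathcomp Require Import zify.

Set Implicit Arguments.
Unset Strict Implicit.
Unset Printing Implicit Defensive.

Import Order.POrderTheory.

(** Say that a coordinate [c] dominates a subgrid of [n^t] for a linear
    extension [L] when [x c < y c] implies [x < y] in [L] for all points [x, y]
    of the subgrid. A large grid contains a large subgrid with a dominating
    coordinate: were every coordinate to lose, one could go around a cycle of
    points, each step being either a loss (one coordinate rises through its
    whole range while all the others fall by a small amount) or a decrease in
    the product order, which is impossible. Iterating over [L_1, ..., L_k]
    gives one subgrid with a dominating coordinate [c_i] for each [L_i].

    Use coordinates [(x, l)], with [x] in [X] and [l] ranging over [k + 1]
    values. Send [a] to the point whose coordinate [(x, l)] is the rank of [a]
    in [M] if [(x, l)] is one of the [c_i], and the truth value of [x <= a]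
    otherwise. All coordinates are monotone, every [L_i] sees the order [M], and
    since at least one copy [(x, l)] of each [x] is not a [c_i], incomparable
    elements stay incomparable. *)

(** * Preorders on [nat^t] and separated intervals *)

Definition monotone_preorder t (L : rel ('I_t -> nat)) : Prop :=
  [/\ transitive L, total L
    & forall x y : 'I_t -> nat, (forall j, x j <= y j) -> L x y].

(** Coordinate [c] overrules the others across the gap from [p] to [q]: elsewhere [x] may exceed [y]
    by as much as [hi j - lo j]. *)
Definition separates t (L : rel ('I_t -> nat)) (c : 'I_t) (p q : nat)
    (lo hi : 'I_t -> nat) : Prop :=
  forall x y : 'I_t -> nat, x c <= p -> q <= y c ->
    (forall j, j != c -> x j <= hi j /\ lo j <= y j) -> L x y.

Definition dominates t (L : rel ('I_t -> nat)) (c : 'I_t) (m : nat) : Prop :=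
  forall u v : 'I_t -> nat, (forall j, u j < m) -> (forall j, v j < m) ->
    u c < v c -> L u v.

Definition pull t (h : 'I_t -> nat -> nat) (L : rel ('I_t -> nat)) :
    rel ('I_t -> nat) :=
  fun u v => L (fun j => h j (u j)) (fun j => h j (v j)).

Definition increasing (h : nat -> nat) : Prop := forall i, h i < h i.+1.

Lemma increasing_lt h : increasing h -> {mono h : i j / i < j}.
Proof.
move=> hh; apply: leqW_mono; apply: leq_mono.
by apply: homo_ltn => //; apply: ltn_trans.
Qed.

Lemma increasing_le h : increasing h -> {mono h : i j / i <= j}.
Proof. by move=> /increasing_lt hh i j; rewrite leqNgt hh -leqNgt. Qed.

Lemma pull_monotone t (h : 'I_t -> nat -> nat) (L : rel ('I_t -> nat)) :
  (forall j, increasing (h j)) -> monotone_preorder L ->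
  monotone_preorder (pull h L).
Proof.
move=> hh [Ltr Lto Lmon]; split => [y x z|x y|x y xy].
- exact: Ltr.
- exact: Lto.
- by apply: Lmon => j; rewrite increasing_le.
Qed.

(* The cyclic distance from step [c] to coordinate [j]: along the cycle of
   steps, coordinate [j] falls through the slots [t - 1, ..., 1] at the steps
   [j + 1, ..., t - 1, 0, ..., j - 1], and rises back at step [j]. *)
Definition slot (t c j : nat) : nat := if j < c then t + j - c else j - c.

Lemma exists_separating_coordinate t (L : rel ('I_t.+1 -> nat))
    (a : 'I_t.+1 -> nat) (s : nat) :
  monotone_preorder L ->
  exists c : 'I_t.+1, separates L c (a c) (a c + t.+1 * s)
    (fun j => a j + slot t.+1 c j * s)
    (fun j => a j + (slot t.+1 c j).+1 * s).
Proof.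
move=> [Ltr Lto Lmon].
(* [x c] is the largest admissible lower point for direction [c] and [y c] the smallest admissible
   upper point, so comparing these two decides separation. *)
pose x (c : nat) (j : 'I_t.+1) :=
  if j == c :> nat then a j else a j + (slot t.+1 c j).+1 * s.
pose y (c : nat) (j : 'I_t.+1) :=
  if j == c :> nat then a j + t.+1 * s else a j + slot t.+1 c j * s.
have Lrefl z : L z z by apply: Lmon.
have [/existsP[c Lc]|/existsPn loses] :=
    boolP [exists c : 'I_t.+1, L (x c) (y c)].
  exists c => u v uc vc uv.
  apply: (Ltr (x c)); last apply: (Ltr (y c)) => //; apply: Lmon => j;
    rewrite /x /y; have [->|jc] := eqVneq j c; rewrite ?eqxx //;
    move: (uv j jc); rewrite -val_eqE in jc; rewrite (negbTE jc); by case.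
have lose c : c <= t -> L (y c) (x c).
  move=> ct; have := loses (Ordinal (ct : c < t.+1)).
  by have /orP[->|] := Lto (x c) (y c).
(* The two points agree except at coordinate [c.+1], where [x c.+1] has the bottom value [a] and
   [y c] has [a + s]. *)
have step c : c < t -> L (x c.+1) (y c).
  move=> ct; apply: Lmon => j; rewrite /x /y /slot.
  have := ltn_ord j; move: (nat_of_ord j) (a j) => i b it.
  by repeat case: ifP => ?; rewrite ?leq_addr ?leq_add2l ?leq_mul2r; lia.
have chain c : c <= t -> L (x c) (x 0).
  elim: c => // c IHc ct.
  apply: (Ltr (x c)); last exact: IHc (ltnW ct).
  by apply: (Ltr (y c)); [exact: step | exact: lose (ltnW ct)].
have close : L (x 0) (y t).
  apply: Lmon => j; rewrite /x /y /slot.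
  have := ltn_ord j; move: (nat_of_ord j) (a j) => i b it.
  by repeat case: ifP => ?; rewrite ?ltn0 ?leq_addr ?leq_add2l ?leq_mul2r; lia.
have := loses (Ordinal (ltnSn t)).
by rewrite /= (Ltr _ _ _ (chain t (leqnn t)) close).
Qed.

Lemma separates_weaken t (L : rel ('I_t -> nat)) c p q q'
    (lo hi lo' hi' : 'I_t -> nat) :
  q <= q' -> (forall j, lo j <= lo' j) -> (forall j, hi' j <= hi j) ->
  separates L c p q lo hi -> separates L c p q' lo' hi'.
Proof.
move=> qq ll hh sep x y xc yc xy; apply: sep => //; first exact: leq_trans yc.
move=> j /xy[xj yj]; split; first exact: leq_trans (hh j).
exact: leq_trans yj.
Qed.

(* Each step yields a separated interval for one more coordinate [c]. The box
   is then moved above that interval in direction [c], and shrunk in the other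
   directions, so that all intervals found earlier remain separated. *)
Lemma iterate_separation t (L : rel ('I_t.+1 -> nat)) (r s : nat) :
  monotone_preorder L -> 0 < s ->
  exists (w : 'I_t.+1 -> nat) (h : 'I_t.+1 -> nat -> nat),
    [/\ \sum_j w j = r,
        forall j, increasing (h j),
        forall j, h j (w j) + s <= t.+2 ^ r * s
      & forall c i, i < w c -> separates L c (h c i) (h c i.+1)
          (fun j => h j (w j)) (fun j => h j (w j) + s)].
Proof.
move=> Lmon; elim: r s => [|r IHr] s s0.
  exists (fun=> 0), (fun=> id); split=> //.
  - by rewrite big1.
  - by move=> j i.
  - by rewrite expn0 mul1n.
(* The old box needs side [t.+2 * s]: its corner moves by at most [t.+1 * s], and a box of side [s]
   must still fit. *)
have [|w [h [wr hh hb hs]]] := IHr (t.+2 * s); first by rewrite muln_gt0.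
have [c sepc] := exists_separating_coordinate (fun j => h j (w j)) s Lmon.
(* [w j] counts the intervals found in direction [j], and [d] moves the corner of the box. The index
   shift in direction [c] keeps the old corner value as lower end of the new interval. *)
pose w' j := w j + (j == c).
pose d j := (if j == c then t.+1 else slot t.+1 c j) * s.
pose h' j i := if i < w' j then h j i else h j (i - (j == c)) + d j.
have ts : 0 < t.+1 * s by rewrite muln_gt0.
have slot_le (j : 'I_t.+1) : slot t.+1 c j <= t.
  by rewrite /slot; case: ifP; have := ltn_ord j; have := ltn_ord c; lia.
have d_le j : d j + s <= t.+2 * s.
  rewrite /d -mulSnr leq_mul //; case: ifP => // _.
  by apply: ltnW; rewrite !ltnS slot_le.
have low j : h' j (w' j) = h j (w j) + d j by rewrite /h' ltnn addnK.
have old j i : i < w' j -> h' j i = h j i by rewrite /h' => ->.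
exists w', h'; split.
- rewrite big_split /= wr -[RHS]addn1; congr (_ + _).
  by rewrite (bigD1 c) //= eqxx big1 // => j /negbTE->.
- move=> j i; rewrite /h'.
  case: (ltnP i (w' j)) => [iw|wi]; case: (ltnP i.+1 (w' j)) => [iw'|wi'].
  + exact: hh.
  + have -> : i.+1 = w' j by apply/eqP; rewrite eqn_leq iw wi'.
    rewrite addnK; move: iw; rewrite /w' /d; case: eqP => [->|_] iw.
      rewrite addn1 ltnS in iw.
      apply: (@leq_ltn_trans (h c (w c))); first by rewrite increasing_le.
      by rewrite -[X in X < _]addn0 ltn_add2l.
    by apply: ltn_addr; rewrite increasing_lt //; lia.
  + by lia.
  + rewrite ltn_add2r increasing_lt //; move: wi; rewrite /w'.
    by case: (j == c) => /=; lia.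
- move=> j; rewrite low; apply: leq_trans (_ : _ <= h j (w j) + t.+2 * s) _.
    by rewrite -addnA leq_add2l.
  by rewrite expnSr -mulnA.
- move=> e i iw.
  have [iwe|wie] := ltnP i (w e).
    rewrite old; last by rewrite /w' ltn_addr.
    apply: separates_weaken (hs e i iwe) => [|j|j].
    + have [/old->//|wi] := ltnP i.+1 (w' e).
      (* Here the upper end is the moved corner, which only went up. *)
      apply: leq_trans (_ : h e (w e) <= _); first by rewrite increasing_le.
      rewrite (_ : i.+1 = w' e) ?low ?leq_addr //.
      by apply/eqP; rewrite eqn_leq iw wi.
    + by rewrite low leq_addr.
    + by rewrite low -addnA leq_add2l.
  have /eqP ec : e == c by move: iw; rewrite /w'; case: eqP => //; lia.
  subst e; have ei : i = w c by move: iw; rewrite /w' eqxx; lia.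
  subst i; rewrite old // (_ : (w c).+1 = w' c); last by rewrite /w' eqxx addn1.
  rewrite low /d eqxx => x y xc yc xy; apply: sepc => // j jc.
  move: (xy j jc); rewrite low /d (negbTE jc) => -[xj yj]; split=> //.
  by rewrite mulSnr addnA.
Qed.

(** * Dominated subgrids *)

Lemma exists_dominated_subgrid t (L : rel ('I_t.+1 -> nat)) (m : nat) :
  monotone_preorder L -> 0 < m ->
  exists (c : 'I_t.+1) (h : 'I_t.+1 -> nat -> nat),
    [/\ forall j, increasing (h j),
        forall j i, i < m -> h j i < t.+2 ^ (t.+1 * m) * m
      & dominates (pull h L) c m].
Proof.
move=> Lmon m0.
have [w [h [wr hh hb hs]]] := iterate_separation (t.+1 * m) Lmon m0.
(* By pigeonhole, some direction has [m] of the [t.+1 * m] intervals. The other coordinates will run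
   through the final box, of side [m]. *)
have [c wc] : exists c, m <= w c.
  case: (boolP [exists c, m <= w c]) => [/existsP//|/existsPn small].
  have : \sum_j (w j + 1) <= \sum_(j < t.+1) m.
    by apply: leq_sum => j _; rewrite addn1 ltnNge.
  by rewrite big_split /= wr !sum_nat_const card_ord; lia.
pose g j i := if j == c then h j i else h j (w j) + i.
exists c, g; split.
- by move=> j i; rewrite /g; case: ifP => _; [exact: hh | lia].
- move=> j i im; rewrite /g; apply: leq_trans (hb j).
  case: ifP => [/eqP->|_]; last by rewrite ltn_add2l.
  rewrite -addn1; apply: leq_add m0.
  by rewrite increasing_le // ltnW // (leq_trans im).
- move=> u v um vm uv; rewrite /pull; apply: (hs c (u c)).
  + exact: leq_trans (um c) wc.
  + by rewrite /g eqxx.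
  + by rewrite /g eqxx increasing_le.
  + move=> j jc; rewrite /g (negbTE jc) leq_addr; split => //.
    by rewrite leq_add2l ltnW.
Qed.

(** Domination passes to subgrids, so the subgrid for [L ord0] is chosen first and refined for the
    remaining relations. *)
Lemma exists_common_dominated_subgrid t (k m : nat) : 0 < m ->
  exists n : nat, forall L : 'I_k -> rel ('I_t.+1 -> nat),
    (forall i, monotone_preorder (L i)) ->
    exists (c : 'I_k -> 'I_t.+1) (h : 'I_t.+1 -> nat -> nat),
      [/\ forall j, increasing (h j), forall j i, i < m -> h j i < n
        & forall i, dominates (pull h (L i)) (c i) m].
Proof.
move=> m0; elim: k => [|k [n IH]].
  by exists m => L _; exists (fun=> ord0), (fun=> id); split=> [j i|j i|[]].
exists (t.+2 ^ (t.+1 * n.+1) * n.+1) => L Lmon.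
have [c [h [hh hb hd]]] := exists_dominated_subgrid (Lmon ord0) (ltn0Sn n).
have [|c' [h' [hh' hb' hd']]] := IH (fun i => pull h (L (lift ord0 i))).
  by move=> i; apply: pull_monotone.
exists (fun i => if unlift ord0 i is Some i' then c' i' else c).
exists (fun j i => h j (h' j i)); split.
- by move=> j i; rewrite increasing_lt //; apply: hh'.
- by move=> j i im; apply: hb; apply: ltnW; apply: hb'.
- move=> i; case: unliftP => [i'|] ->; first exact: hd'.
  move=> u v um vm uv; apply: (hd (fun j => h' j (u j)) (fun j => h' j (v j))).
  + by move=> j; apply: ltnW; apply: hb'.
  + by move=> j; apply: ltnW; apply: hb'.
  + by rewrite increasing_lt.
Qed.

Lemma exists_notin_codom (k : nat) (T : eqType) (g : 'I_k.+1 -> T)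
    (c : 'I_k -> T) :
  injective g -> exists l, g l \notin codom c.
Proof.
move=> ginj; apply/existsP; apply: contraT => /existsPn gc.
have := @uniq_leq_size _ (codom g) (codom c).
rewrite !size_codom !card_ord ltnn => -> //.
  by rewrite map_inj_uniq // enum_uniq.
by move=> _ /codomP[l ->]; have := gc l; rewrite negbK.
Qed.

(** * Ranks and the passage to the finite grid *)

Definition lin_rank (T : finType) (M : rel T) (a : T) : nat :=
  #|[pred b | lin_lt M b a]|.

Lemma lin_rank_lt (d : Order.disp_t) (X : finPOrderType d) (M : rel X)
    (a b : X) :
  linear_extension M -> lin_lt M a b -> lin_rank M a < lin_rank M b.
Proof.
move=> [_ Manti Mtr _ _] ab.
apply: proper_card; apply/properP; split.
  apply/subsetP => z; rewrite !inE /lin_lt => /andP[za Mza].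
  have /andP[nab Mab] := ab; rewrite (Mtr a) // andbT.
  by apply: contraNneq za => zb; apply/eqP/Manti; rewrite Mza zb Mab.
by exists a; rewrite !inE // /lin_lt eqxx.
Qed.

Lemma lin_rank_le (d : Order.disp_t) (X : finPOrderType d) (M : rel X)
    (a b : X) :
  linear_extension M -> (a <= b)%O -> lin_rank M a <= lin_rank M b.
Proof.
move=> hM ab; have [_ _ _ _ Mext] := hM.
have [->//|nab] := eqVneq a b.
by apply/ltnW/lin_rank_lt => //; rewrite /lin_lt nab Mext.
Qed.

Lemma lin_rank_max (T : finType) (M : rel T) (a : T) : lin_rank M a <= #|T|.
Proof. exact: max_card. Qed.

(** Truncation is monotone on all of [nat^t], so a linear extension of the grid pulls back to a
    total preorder there. *)
Definition clamp n t (x : 'I_t -> nat) : chain_power n.+1 t :=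
  [tuple inord (minn (x j) n) | j < t].

Lemma clamp_le n t (x y : 'I_t -> nat) :
  (clamp n x <= clamp n y)%O <-> (forall j, minn (x j) n <= minn (y j) n).
Proof.
have ceil (m : nat) : minn m n < n.+1 by rewrite ltnS geq_minr.
rewrite leEtprod; split=> [/forallP xy j | xy].
  by have := xy j; rewrite !tnth_mktuple leEord !inordK.
by apply/forallP => j; rewrite !tnth_mktuple leEord !inordK.
Qed.

Lemma clamp_monotone n t (L : rel (chain_power n.+1 t)) :
  linear_extension L ->
  monotone_preorder (fun x y : 'I_t -> nat => L (clamp n x) (clamp n y)).
Proof.
move=> [_ _ Ltr Lto Lext]; split=> [y x z|x y|x y xy].
- exact: Ltr.
- exact: Lto.
- by apply/Lext/clamp_le => j; have := xy j; lia.
Qed.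

Theorem theorem7p1 (d : Order.disp_t) (X : finPOrderType d) (M : rel X)
    (hM : linear_extension M) (k : nat) (hk : 0 < k) :
  exists n t : nat, 0 < n /\ 0 < t /\
    forall L : 'I_k -> rel (chain_power n t),
      (forall i : 'I_k, linear_extension (L i)) ->
      exists f : X -> chain_power n t,
        embedding f /\
        forall (i : 'I_k) (a b : X),
          lin_lt M a b <-> lin_lt (L i) (f a) (f b).
Proof.
(* [m] exceeds every rank and both truth values. Among the [t.+1] coordinates, [ord0] is a spare
   one, set to 0 unless it lies in [codom c]. *)
pose t := #|{: X * 'I_k.+1}|; pose m := #|X|.+2.
have [n Hn] := exists_common_dominated_subgrid t k (ltn0Sn #|X|.+1).
exists n.+1, t.+1; do 2!split=> //; move=> L hL.
have [c [h [hh hb hd]]] := Hn _ (fun i => clamp_monotone (hL i)).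
pose u (a : X) (j : 'I_t.+1) : nat :=
  if j \in codom c then lin_rank M a
  else if unlift ord0 j is Some j' then ((enum_val j').1 <= a)%O else 0.
pose f a := clamp n (fun j => h j (u a j)).
have um a j : u a j < m.
  rewrite /u /m; case: ifP => _; first by rewrite ltnS leqW // lin_rank_max.
  by case: unlift => // j'; case: (_ <= _)%O.
have femb : embedding f.
  move=> a b; split=> [ab|/clamp_le fab].
    apply/clamp_le => j.
    suff : h j (u a j) <= h j (u b j) by lia.
    rewrite increasing_le // /u; case: ifP => _; first exact: lin_rank_le.
    case: unlift => // j'.
    by case: (boolP (_ <= a)%O) => // xa; rewrite (le_trans xa).
  have [|l lc] := @exists_notin_codom k _
      (fun l : 'I_k.+1 => lift ord0 (enum_rank (a, l))) c.
    by move=> l l' /lift_inj/enum_rank_inj[].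
  have := fab (lift ord0 (enum_rank (a, l))).
  have minE z j : minn (h j (u z j)) n = h j (u z j).
    by apply/minn_idPl/ltnW/hb/um.
  rewrite !minE increasing_le // /u (negbTE lc) liftK enum_rankK /=.
  by rewrite lexx; case: (_ <= _)%O.
have finj : injective f.
  by move=> a b fab; apply/le_anti/andP; split;
    apply/femb; rewrite fab lexx.
have mono i a b : lin_lt M a b -> lin_lt (L i) (f a) (f b).
  move=> ab; rewrite /lin_lt (inj_eq finj) (andP ab).1 /=.
  apply: (hd i) => //.
  by rewrite /u codom_f; apply: lin_rank_lt.
exists f; split=> // i a b; split; first exact: mono.
move=> /andP[]; rewrite (inj_eq finj) => nab Lab.
have [_ _ _ Mto _] := hM; rewrite /lin_lt nab.
have /orP[//|Mba] := Mto a b.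
have /(mono i)/andP[nba Lba] : lin_lt M b a by rewrite /lin_lt eq_sym nab.
have [_ Lanti _ _ _] := hL i.
by case/eqP: nba; apply: Lanti; rewrite Lab Lba.
Qed.
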